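(* Let $(M,\varphi,\xi,\eta,g)$ be a $3$-dimensional trans-Sasakian manifold equipped with a Newman--Penrose frame $(\partial,\overline{\partial},\xi)$. Then the structure vector field $\xi$ is parallel (i.e. $\nabla\xi=0$) if and only if $M$ is cosymplectic.
   Context: An almost contact metric structure $(\varphi,\xi,\eta,g)$ on $M$: $\varphi$ a $(1,1)$-tensor, $\xi$ a vector field, $\eta$ a $1$-form, $g$ a Riemannian metric with $\varphi^2=-I+\eta\otimes\xi$, $\eta(\xi)=1$, $\varphi\xi=0$, $\eta\circ\varphi=0$, $g(\varphi X,\varphi Y)=g(X,Y)-\eta(X)\eta(Y)$. It is trans-Sasakian of type $(\alpha,\beta)$ ($\alpha,\beta$ smooth functions) if $(\nabla_X\varphi)Y=\alpha(g(X,Y)\xi-\eta(Y)X)+\beta(g(\varphi X,Y)\xi-\eta(Y)\varphi X)$, with $\nabla$ the Levi-Civita connection; it is cosymplectic if $\alpha=\beta=0$. Newman--Penrose frame: for an orthonormal frame $(e_1,e_2,\xi)$, $\partial=\frac1{\sqrt2}(e_1-ie_2)$, $\overline{\partial}=\frac1{\sqrt2}(e_1+ie_2)$, chosen so that $\varphi\partial=i\partial$, $\varphi\overline{\partial}=-i\overline{\partial}$ (i.e. $\varphi e_1=e_2$). With $\sigma_{\mathrm{np}}=-g(\partial,\nabla_\partial\xi)$, $\rho_{\mathrm{np}}=g(\partial,\nabla_{\overline{\partial}}\xi)$, $\kappa_{\mathrm{np}}=-g(\partial,\nabla_\xi\xi)$ (complex-bilinear extension of $g$), the trans-Sasakian condition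 of type $(\alpha,\beta)$ reads $\kappa_{\mathrm{np}}=\sigma_{\mathrm{np}}=0$, $\rho_{\mathrm{np}}=\beta+i\alpha$. *)

(* Defs.v *)
From HB Require Import structures.
From mathcomp Require Import all_boot all_order all_algebra.
From mathcomp Require Import all_classical all_reals all_analysis.
From mathcomp Require Import ring.

Set Implicit Arguments.
Unset Strict Implicit.
Unset Printing Implicit Defensive.

Import Order.TTheory GRing.Theory Num.Theory.
Import numFieldNormedType.Exports.

Local Open Scope classical_set_scope.
Local Open Scope ring_scope.

(* Real matrices carry a normed structure only in nonzero dimensions, hence the
   Euclidean model space 'rV[R]_n.+1 throughout. *)
Section SmoothOn.
Context {R : realType} {n : nat}.
Implicit Types (U : set 'rV[R]_n.+1) (f g : 'rV[R]_n.+1 -> R).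

(* Only used on open U, where continuity at the points of U is continuity on U:
   all partial derivatives of order at most k exist and are continuous on U. *)
Fixpoint Ck (k : nat) U f : Prop :=
  (forall x, U x -> {for x, continuous f}) /\
  if k is k'.+1 then
    forall i : 'I_n.+1, (forall x, U x -> derivable f x (delta_mx 0 i)) /\
                        Ck k' U ('D_(delta_mx 0 i) f)
  else True.

Definition smooth_on U f : Prop := forall k, Ck k U f.

Lemma Ck_cont k U f : Ck k U f -> forall x, U x -> {for x, continuous f}.
Proof. by case: k => [|k] []. Qed.

Lemma Ck_eq k U f g : open U -> (forall x, U x -> f x = g x) ->
  Ck k U f -> Ck k U g.
Proof.
move=> oU; have near_eq f' g' x : (forall x, U x -> f' x = g' x) -> U x ->
    \forall y \near x, f' y = g' y.
  by move=> fg Ux; apply: filterS (open_nbhs_nbhs (conj oU Ux)).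
have contE f' g' : (forall x, U x -> f' x = g' x) ->
    (forall x, U x -> {for x, continuous f'}) ->
    forall x, U x -> {for x, continuous g'}.
  move=> fg cf x Ux; have := cf x Ux; rewrite /prop_for /continuous_at => cfx.
  rewrite -(fg x Ux).
  exact: cvg_trans (near_eq_cvg (near_eq _ _ x fg Ux)) cfx.
elim: k f g => [|k IHk] f g fg [cf df]; first by split=> //; exact: contE cf.
split; first exact: contE cf.
move=> i; have [dfi Cfi] := df i; split.
  by move=> x Ux; apply: near_eq_derivable (dfi x Ux); exact: near_eq.
by apply: IHk Cfi => x Ux; apply: near_eq_derive; exact: near_eq.
Qed.

Lemma CkW k U f : Ck k.+1 U f -> Ck k U f.
Proof.
elim: k f => [|k IHk] f [cf df]; first by split.
split=> // i; have [dfi Cfi] := df i; split=> //; exact: IHk.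
Qed.

Lemma Ck_cst k U (c : R) : Ck k U (cst c).
Proof.
elim: k c => [|k IHk] c; split=> //; try by move=> x _; exact: cst_continuous.
move=> i; split; first by move=> x _; exact: derivable_cst.
rewrite (_ : 'D_(delta_mx 0 i) _ = cst 0); first exact: IHk.
by apply/funext => x; rewrite derive_cst.
Qed.

Lemma Ck_add k U f g : open U -> Ck k U f -> Ck k U g -> Ck k U (f + g).
Proof.
move=> oU; elim: k f g => [|k IHk] f g [cf df] [cg dg].
  by split=> // x Ux; apply: continuousD; [exact: cf|exact: cg].
split; first by move=> x Ux; apply: continuousD; [exact: cf|exact: cg].
move=> i; have [dfi Cfi] := df i; have [dgi Cgi] := dg i; split.
  by move=> x Ux; apply: derivableD; [exact: dfi|exact: dgi].
apply: (Ck_eq oU) (IHk _ _ Cfi Cgi) => x Ux.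
by rewrite deriveD //; [exact: dfi|exact: dgi].
Qed.

Lemma Ck_mul k U f g : open U -> Ck k U f -> Ck k U g -> Ck k U (f * g).
Proof.
move=> oU; elim: k f g => [|k IHk] f g Cf Cg.
  case: Cf => cf _; case: Cg => cg _.
  by split=> // x Ux; apply: continuousM; [exact: cf|exact: cg].
have Cf' := CkW Cf; have Cg' := CkW Cg; case: Cf => cf df; case: Cg => cg dg.
split; first by move=> x Ux; apply: continuousM; [exact: cf|exact: cg].
move=> i; have [dfi Cfi] := df i; have [dgi Cgi] := dg i; split.
  by move=> x Ux; apply: derivableM; [exact: dfi|exact: dgi].
apply: (Ck_eq oU) (Ck_add oU (IHk _ _ Cf' Cgi) (IHk _ _ Cg' Cfi)) => x Ux.
by rewrite deriveM //; [exact: dfi|exact: dgi].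
Qed.

End SmoothOn.

Record chart (R : realType) (n : nat) (M : topologicalType) := Chart {
  chart_dom : set M;
  chart_img : set 'rV[R]_n.+1;
  chart_map :> M -> 'rV[R]_n.+1;
  chart_inv : 'rV[R]_n.+1 -> M;
  chart_dom_open : open chart_dom;
  chart_img_open : open chart_img;
  chart_map_img : forall p, chart_dom p -> chart_img (chart_map p);
  chart_inv_dom : forall x, chart_img x -> chart_dom (chart_inv x);
  chart_mapK : forall p, chart_dom p -> chart_inv (chart_map p) = p;
  chart_invK : forall x, chart_img x -> chart_map (chart_inv x) = x;
  chart_map_continuous :
    forall p, chart_dom p -> {for p, continuous chart_map};
  chart_inv_continuous :
    forall x, chart_img x -> {for x, continuous chart_inv}
}.

Arguments chart_dom_open {R n M} c.
Arguments chart_img_open {R n M} c.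

Definition compatible (R : realType) (n : nat) (M : topologicalType)
    (c d : chart R n M) : Prop :=
  forall i : 'I_n.+1,
    smooth_on (chart_img c `&` chart_inv c @^-1` chart_dom d)
              (fun x => d (chart_inv c x) 0 i).

(* Beware of the shift: [manifold R n] is the type of smooth manifolds of
   dimension n.+1. *)
Record manifold (R : realType) (n : nat) := Manifold {
  carrier :> topologicalType;
  atlas : set (chart R n carrier);
  atlas_cover : forall p : carrier, exists2 c, atlas c & chart_dom c p;
  atlas_compatible : forall c d, atlas c -> atlas d -> compatible c d;
  manifold_hausdorff : hausdorff_space carrier;
  manifold_second_countable : @second_countable carrier
}.

Section SmoothFunctions.
Context {R : realType} {n : nat} (M : manifold R n).

Definition smooth (f : M -> R) : Prop :=
  forall c, @atlas R n M c -> smooth_on (chart_img c) (f \o chart_inv c).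

Definition smooth_pred : {pred M -> R} := fun f => `[< smooth f >].

Lemma smooth_cst (a : R) : smooth (cst a).
Proof. by move=> c _ k; exact: Ck_cst. Qed.

Lemma smooth_subring_closed : subring_closed smooth_pred.
Proof.
have addS f g : smooth f -> smooth g -> smooth (f + g).
  move=> sf sg c Ac k.
  exact: (Ck_add (chart_img_open c) (sf c Ac k) (sg c Ac k)).
have mulS f g : smooth f -> smooth g -> smooth (f * g).
  move=> sf sg c Ac k.
  exact: (Ck_mul (chart_img_open c) (sf c Ac k) (sg c Ac k)).
split=> [|f g /asboolP sf /asboolP sg|f g /asboolP sf /asboolP sg].
- by apply/asboolP; exact: smooth_cst.
- apply/asboolP; apply: addS => //; rewrite -mulN1r; apply: mulS => //.
  exact: (smooth_cst (-1)).
- by apply/asboolP; exact: mulS.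
Qed.

HB.instance Definition _ :=
  GRing.isSubringClosed.Build (M -> R) smooth_pred smooth_subring_closed.

Record smoothFun := SmoothFun {
  smooth_val :> M -> R;
  smooth_valP : smooth_val \in smooth_pred
}.

HB.instance Definition _ := [isSub of smoothFun for smooth_val].
HB.instance Definition _ := [Choice of smoothFun by <:].
HB.instance Definition _ :=
  GRing.SubChoice_isSubComPzRing.Build (M -> R) smooth_pred smoothFun
    smooth_subring_closed.

Lemma smooth_cst_pred (a : R) : cst a \in smooth_pred.
Proof. by apply/asboolP; exact: smooth_cst. Qed.

Definition csmooth (a : R) : smoothFun := SmoothFun (smooth_cst_pred a).

End SmoothFunctions.

Notation "''C^oo' ( M )" := (smoothFun M) (at level 8, format "''C^oo' ( M )").

(* Vector fields are the R-linear derivations of the ring of smooth functions;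
   they form a module over that ring. *)
Section VectorFields.
Context {R : realType} {n : nat} (M : manifold R n).

Definition derivation (D : 'C^oo(M) -> 'C^oo(M)^o) : Prop :=
  [/\ forall f g, D (f + g) = D f + D g,
      forall (a : R) f, D (csmooth M a * f) = csmooth M a * D f
    & forall f g, D (f * g) = D f * g + f * D g].

Definition derivation_pred : {pred 'C^oo(M) -> 'C^oo(M)^o} :=
  fun D => `[< derivation D >].

Lemma derivation_submod_closed : submod_closed derivation_pred.
Proof.
split.
  apply/asboolP; split=> [f g|a f|f g] /=.
  - by rewrite /GRing.zero /= addr0.
  - by rewrite /GRing.zero /= mulr0.
  - by rewrite /GRing.zero /= mul0r mulr0 addr0.
move=> h D E /asboolP[D1 D2 D3] /asboolP[E1 E2 E3].
have hE f : (h *: D + E) f = h * D f + E f by [].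
apply/asboolP; split=> [f g|a f|f g]; rewrite !hE.
- by rewrite D1 E1 mulrDr addrACA.
- by rewrite D2 E2 mulrDr mulrCA.
- by rewrite D3 E3 !mulrDr mulrDl addrACA !mulrA (mulrC f h).
Qed.

HB.instance Definition _ :=
  GRing.isSubmodClosed.Build 'C^oo(M) ('C^oo(M) -> 'C^oo(M)^o)
    derivation_pred derivation_submod_closed.

Record vfield := VField {
  vact :> 'C^oo(M) -> 'C^oo(M)^o;
  vactP : vact \in derivation_pred
}.

HB.instance Definition _ := [isSub of vfield for vact].
HB.instance Definition _ := [Choice of vfield by <:].
HB.instance Definition _ := [SubChoice_isSubLmodule of vfield by <:].

Lemma lie_bracket_pred (X Y : vfield) :
  (fun f => X (Y f) - Y (X f)) \in derivation_pred.
Proof.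
case: X Y => [X /asboolP[X1 X2 X3]] [Y /asboolP[Y1 Y2 Y3]] /=.
apply/asboolP; split=> [f g|a f|f g].
- by rewrite Y1 X1 X1 Y1 opprD addrACA.
- by rewrite Y2 X2 X2 Y2 mulrBr.
- rewrite Y3 X1 !X3 Y1 !Y3.
  move: (X f) (X g) (Y f) (Y g) (X (Y f)) (X (Y g)) (Y (X f)) (Y (X g)).
  by move=> a b c d a' b' c' d'; ring.
Qed.

Definition lie_bracket (X Y : vfield) : vfield :=
  VField (lie_bracket_pred X Y).

End VectorFields.

(* Tensor fields are maps on vector fields that are multilinear over the ring of
   smooth functions. *)
Section Riemannian.
Context {R : realType} {n : nat} (M : manifold R n).

(* The tangent vector of X at p is the functional f |-> (X f)(p), so the
   hypothesis of riem_pos says that X does not vanish at p. *)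
Record riem_metric := RiemMetric {
  riem_fun :> vfield M -> vfield M -> 'C^oo(M);
  riem_sym : forall X Y, riem_fun X Y = riem_fun Y X;
  riem_linear : forall (f : 'C^oo(M)) X Y Z,
    riem_fun (f *: X + Y) Z = f * riem_fun X Z + riem_fun Y Z;
  riem_pos : forall (X : vfield M) (p : M),
    (exists f : 'C^oo(M), smooth_val (X f) p <> 0) ->
    0 < smooth_val (riem_fun X X) p
}.

Record connection := Connection {
  nabla :> vfield M -> vfield M -> vfield M;
  nabla_linear : forall (f : 'C^oo(M)) X Y Z,
    nabla (f *: X + Y) Z = f *: nabla X Z + nabla Y Z;
  nabla_add : forall X Y Z, nabla X (Y + Z) = nabla X Y + nabla X Z;
  nabla_leibniz : forall (X : vfield M) (f : 'C^oo(M)) Y,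
    nabla X (f *: Y) = (X f : 'C^oo(M)) *: Y + f *: nabla X Y
}.

Definition levi_civita (g : riem_metric) (D : connection) : Prop :=
  (forall X Y, D X Y - D Y X = lie_bracket X Y) /\
  (forall X Y Z : vfield M, X (g Y Z) = g (D X Y) Z + g Y (D X Z)).

Definition parallel (D : connection) (Y : vfield M) : Prop :=
  forall X, D X Y = 0.

Definition cov_deriv_endo (D : connection) (A : vfield M -> vfield M)
    (X Y : vfield M) : vfield M :=
  D X (A Y) - A (D X Y).

End Riemannian.

Section AlmostContact.
Context {R : realType} {n : nat} (M : manifold R n).

Record almost_contact_metric := AlmostContactMetric {
  phi : {linear vfield M -> vfield M};
  xi : vfield M;
  eta : {linear vfield M -> 'C^oo(M)^o};
  acm_metric : riem_metric M;
  phi_phi : forall X, phi (phi X) = - X + (eta X : 'C^oo(M)) *: xi;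
  eta_xi : eta xi = 1;
  phi_xi : phi xi = 0;
  eta_phi : forall X, eta (phi X) = 0;
  metric_phi : forall X Y,
    acm_metric (phi X) (phi Y) = acm_metric X Y - eta X * eta Y
}.

(* A trans-Sasakian structure comes with its type (alpha, beta). *)
Record trans_sasakian (S : almost_contact_metric) (D : connection M) :=
  TransSasakian {
  ts_alpha : 'C^oo(M);
  ts_beta : 'C^oo(M);
  ts_eq : forall X Y,
    cov_deriv_endo D (phi S) X Y =
      ts_alpha *: (acm_metric S X Y *: xi S - (eta S Y : 'C^oo(M)) *: X) +
      ts_beta *: (acm_metric S (phi S X) Y *: xi S
                  - (eta S Y : 'C^oo(M)) *: phi S X)
}.

Definition cosymplectic (S : almost_contact_metric) (D : connection M)
    (T : trans_sasakian S D) : Prop :=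
  ts_alpha T = 0 /\ ts_beta T = 0.

End AlmostContact.

Section NewmanPenrose.
Context {R : realType} (M : manifold R 2).

(* The pair (X, Y) stands for the complex vector field X + iY. *)
Definition cvfield : Type := (vfield M * vfield M)%type.

Definition cv_real (X : vfield M) : cvfield := (X, 0).
Definition cv_i (Z : cvfield) : cvfield := (- Z.2, Z.1).
Definition cv_map (A : vfield M -> vfield M) (Z : cvfield) : cvfield :=
  (A Z.1, A Z.2).
Definition cv_scale (a : R) (Z : cvfield) : cvfield :=
  (csmooth M a *: Z.1, csmooth M a *: Z.2).

(* In dimension three, orthonormality at each point already makes the triple a
   basis of each tangent space. *)
Definition orthonormal_frame (g : riem_metric M) (e1 e2 e3 : vfield M) : Prop :=
  [/\ g e1 e1 = 1, g e2 e2 = 1 & g e3 e3 = 1] /\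
  [/\ g e1 e2 = 0, g e1 e3 = 0 & g e2 e3 = 0].

(* The third leg of the frame is the structure vector field of S. *)
Definition newman_penrose_frame (S : almost_contact_metric M)
    (del delbar : cvfield) : Prop :=
  exists e1 e2 : vfield M,
    [/\ orthonormal_frame (acm_metric S) e1 e2 (xi S),
        del = cv_scale (Num.sqrt 2)^-1 (cv_real e1 - cv_i (cv_real e2)),
        delbar = cv_scale (Num.sqrt 2)^-1 (cv_real e1 + cv_i (cv_real e2)),
        cv_map (phi S) del = cv_i del
      & cv_map (phi S) delbar = - cv_i delbar].

End NewmanPenrose.

(* Main.v *)
(* Evaluating the trans-Sasakian identity at Y = xi expresses phi (D_X xi) through
   alpha and beta.  If xi is parallel, pairing this at X = e1 with e1 and
   e2 = phi e1 gives alpha = beta = 0.  If alpha = beta = 0, then phi (D_X xi) = 0, so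
   D_X xi is a multiple of xi; since xi has unit length and the connection is metric,
   D_X xi is also orthogonal to xi, hence zero. *)
Require Import Defs.
From mathcomp Require Import all_boot all_order all_algebra.
From mathcomp Require Import all_classical all_reals all_analysis.

Set Implicit Arguments.
Unset Strict Implicit.
Unset Printing Implicit Defensive.

Import Order.TTheory GRing.Theory Num.Theory.

Local Open Scope ring_scope.

Section SmoothScalars.
Context {R : realType} {n : nat} (M : manifold R n).

Lemma csmooth1 : csmooth M 1 = 1.
Proof. exact: val_inj. Qed.

Lemma csmoothM (a b : R) : csmooth M (a * b) = csmooth M a * csmooth M b.
Proof. exact: val_inj. Qed.

(** The constant function [a^-1] is smooth, so scaling by it undoes scaling by [a]. This removes the
    factor [1 / sqrt 2] from the Newman-Penrose legs. *)
Lemma csmooth_scaler_inj (V : lmodType 'C^oo(M)) (a : R) :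
  a != 0 -> injective (fun X : V => csmooth M a *: X).
Proof.
move=> a0 X Y /(congr1 (fun Z => csmooth M a^-1 *: Z)).
by rewrite !scalerA -csmoothM mulVf // csmooth1 !scale1r.
Qed.

(** Smooth functions may have zero divisors, so the factor 2 is cancelled pointwise, in the field
    [R]. *)
Lemma smooth_double_eq0 (f : 'C^oo(M)) : f + f = 0 -> f = 0.
Proof.
move=> ff0; apply: val_inj; apply/funext => p.
have : smooth_val f p + smooth_val f p = 0.
  have := congr1 (fun h : 'C^oo(M) => val h p) ff0.
  by rewrite raddfD raddf0.
by rewrite -mulr2n => /eqP; rewrite mulrn_eq0 /= => /eqP.
Qed.

(** The Leibniz rule at [1 * 1] gives [X 1 = X 1 + X 1]. *)
Lemma vfield1 (X : vfield M) : X 1 = 0.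
Proof.
have /asboolP[_ _ XM] := vactP X.
have := XM 1 1; rewrite !mul1r mulr1 => X1.
by apply: (@addrI _ (X 1)); rewrite addr0 -X1.
Qed.

End SmoothScalars.

Section RiemannianAlgebra.
Context {R : realType} {n : nat} {M : manifold R n} (g : riem_metric M).

Lemma riem0l Z : g 0 Z = 0.
Proof.
have := riem_linear g 1 0 0 Z; rewrite scaler0 addr0 mul1r => g00.
by apply: (@addrI _ (g 0 Z)); rewrite addr0 -g00.
Qed.

Lemma riemZl (f : 'C^oo(M)) X Z : g (f *: X) Z = f * g X Z.
Proof. by have := riem_linear g f X 0 Z; rewrite riem0l !addr0. Qed.

Lemma riemDl X Y Z : g (X + Y) Z = g X Z + g Y Z.
Proof. by have := riem_linear g 1 X Y Z; rewrite scale1r mul1r. Qed.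

Lemma riemNl X Z : g (- X) Z = - g X Z.
Proof. by rewrite -scaleN1r riemZl mulN1r. Qed.

Lemma riem0r Z : g Z 0 = 0.
Proof. by rewrite riem_sym riem0l. Qed.

Lemma nabla0r (D : connection M) X : D X 0 = 0.
Proof.
have := nabla_add D X 0 0; rewrite addr0 => D00.
by apply: (@addrI _ (D X 0)); rewrite addr0 -D00.
Qed.

(** Differentiating [g Y Y = 1] along [X] gives [0 = 2 g (D X Y) Y], by metric compatibility and
    symmetry. *)
Lemma riem_nabla_unit (D : connection M) X Y :
  levi_civita g D -> g Y Y = 1 -> g (D X Y) Y = 0.
Proof.
move=> [_ gD] gY; have := gD X Y Y.
by rewrite gY vfield1 (riem_sym g Y) => /esym/smooth_double_eq0.
Qed.

End RiemannianAlgebra.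

Section AlmostContactAlgebra.
Context {R : realType} {n : nat} {M : manifold R n}.
Variables (S : almost_contact_metric M) (D : connection M).
Notation g := (acm_metric S).

(** Compatibility of [phi] with the metric, taken at [(X, xi)], has zero left-hand side because
    [phi] kills [xi]. *)
Lemma eta_metric X : eta S X = g X (xi S).
Proof.
have := metric_phi S X (xi S); rewrite phi_xi eta_xi riem0r mulr1.
by move/esym/eqP; rewrite subr_eq0 => /eqP.
Qed.

Lemma metric_xi_xi : g (xi S) (xi S) = 1.
Proof. by rewrite -eta_metric eta_xi. Qed.

(** On the orthogonal complement of [xi], [phi] squares to minus the identity and is therefore
    injective. *)
Lemma phi_eq0 X : phi S X = 0 -> g X (xi S) = 0 -> X = 0.
Proof.
move=> fX gX; have := phi_phi S X.
rewrite fX linear0 eta_metric gX scale0r addr0 => /esym/eqP.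
by rewrite oppr_eq0 => /eqP.
Qed.

Lemma phi_nabla_xi (T : trans_sasakian S D) X :
  - phi S (D X (xi S)) =
    ts_alpha T *: (g X (xi S) *: xi S - X) +
    ts_beta T *: (g (phi S X) (xi S) *: xi S - phi S X).
Proof.
have := ts_eq T X (xi S).
by rewrite /cov_deriv_endo phi_xi nabla0r sub0r eta_xi !scale1r.
Qed.

End AlmostContactAlgebra.

Lemma newman_penrose_phi (R : realType) (M : manifold R 2)
    (S : almost_contact_metric M) (del delbar : cvfield M) :
  newman_penrose_frame S del delbar ->
  exists2 e : vfield M * vfield M,
    orthonormal_frame (acm_metric S) e.1 e.2 (xi S) & phi S e.1 = e.2.
Proof.
move=> [e1 [e2 [frame -> _ phi_del _]]]; exists (e1, e2) => //=.
(* Since [del] is a multiple of [e1 - i e2], the real part of [phi del = i del] is [phi e1 = e2] up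
   to the factor [1 / sqrt 2]. *)
move: phi_del; rewrite /cv_map /cv_scale /cv_i /= => -[+ _].
rewrite opprK addr0 linearZ /= sub0r scalerN opprK.
by move/csmooth_scaler_inj; apply; rewrite invr_eq0 sqrtr_eq0 -ltNge ltr0n.
Qed.

Theorem theorem5p9 (R : realType) (M : manifold R 2)
    (S : almost_contact_metric M)
    (D : connection M) (hD : levi_civita (acm_metric S) D)
    (T : trans_sasakian S D)
    (del delbar : cvfield M) (hNP : newman_penrose_frame S del delbar) :
  parallel D (xi S) <-> cosymplectic T.
Proof.
split=> [xi_par|[a0 b0] X]; last first.
  apply: (@phi_eq0 _ _ _ S); last exact: (riem_nabla_unit _ hD (metric_xi_xi S)).
  have := phi_nabla_xi T X; rewrite a0 b0 !scale0r addr0 => /eqP.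
  by rewrite oppr_eq0 => /eqP.
have [[e1 e2] /= [[g11 g22 _] [g12 g13 g23]] phi1] := newman_penrose_phi hNP.
have := phi_nabla_xi T e1.
(* Both [e1] and [e2 = phi e1] are orthogonal to [xi], so the [xi] terms drop out and
   [alpha e1 + beta e2 = 0] remains, up to sign. *)
rewrite xi_par linear0 oppr0 phi1 g13 g23 !scale0r !sub0r => eq0.
have test Z : ts_alpha T * acm_metric S e1 Z + ts_beta T * acm_metric S e2 Z = 0.
  have := congr1 (fun X => acm_metric S X Z) eq0.
  rewrite riem0l riemDl !riemZl !riemNl !mulrN -opprD => /esym/eqP.
  by rewrite oppr_eq0 => /eqP.
split; first by have := test e1; rewrite g11 riem_sym g12 mulr1 mulr0 addr0.
by have := test e2; rewrite g12 g22 mulr1 mulr0 add0r.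
Qed.
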